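(* Let $G$ be a countable discrete residually finite group equipped with a proper left-invariant metric $d_G$, and let $G=N_0\ge N_1\ge N_2\ge\cdots$ be a sequence of normal subgroups of $G$ of finite index with $\bigcap_{k=0}^\infty N_k=\{1\}$. Let $X$ be the associated box space. Then $X$ has property A if and only if $X$ has naive property A.
   Context: A metric on a discrete group is *left-invariant* if $d_G(gx,gy)=d_G(x,y)$ for all $g,x,y$, and *proper* if every ball of finite radius is finite. The *box space* associated to $(G,d_G)$ and $(N_k)_{k\ge 0}$ is the disjoint union $X=\bigsqcup_{k\ge0}G/N_k$ with a metric $d$ which restricts on each $G/N_k$ to the quotient metric $d(gN_k,hN_k)=\min\{d_G(gn,hm):n,m\in N_k\}$, and such that the distances between different pieces tend to infinity: $d(G/N_k,G/N_l)\to\infty$ as $k+l\to\infty$ with $k\ne l$, where $d(G/N_k,G/N_l)$ denotes the minimal distance between a point of $G/N_k$ and a point of $G/N_l$. A discrete metric space $(X,d)$ has *property A* if for any $R,\varepsilon>0$ there exists a family $\{A_x\}_{x\in X}$ of finite, non-empty subsets of $X\times\mathbb{N}$ such that: (1) for any $x,y\in X$ with $d(x,y)\le R$, $\frac{|A_x\triangle A_y|}{|A_x\cap A_y|}<\varepsilon$; (2) there exists $S>0$ such that for any $x\in X$ and any $(y,n)\in A_x$, $d(x,y)\le S$. A discrete metric space $(X,d)$ has *naive property A* if for any $R,\varepsilon>0$ there exists a family $\{A_x\}_{x\in X}$ of finite, non-empty subsets of $X$ such that: (1) for any $x,y\in X$ with $d(x,y)\le R$, $\frac{|A_x\triangle A_y|}{|A_x\cap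 A_y|}<\varepsilon$; (2) there exists $S>0$ such that for any $x\in X$ and any $y\in A_x$, $d(x,y)\le S$. In both definitions, the inequality in (1) is understood to include that $A_x\cap A_y\neq\emptyset$. *)

(* Defs.v *)
From mathcomp Require Import all_boot all_order all_algebra.
From mathcomp Require Import finmap.
From mathcomp Require Import boolp classical_sets functions cardinality reals.
Set Implicit Arguments.
Unset Strict Implicit.
Unset Printing Implicit Defensive.
Import Order.TTheory GRing.Theory Num.Theory.
Local Open Scope classical_set_scope.
Local Open Scope ring_scope.

Record is_metric (R : realType) (T : Type) (d : T -> T -> R) : Prop := IsMetric {
  metric_refl : forall x, d x x = 0 ;
  metric_pos : forall x y, d x y = 0 -> x = y ;
  metric_sym : forall x y, d x y = d y x ;
  metric_triangle : forall x y z, d x z <= d x y + d y z }.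

Definition is_min (R : realType) (m : R) (S : set R) : Prop :=
  S m /\ lbound S m.

Section Groups.
Variable G : groupType.
Implicit Types (N : set G) (g : G).

Definition left_invariant (R : realType) (d : G -> G -> R) : Prop :=
  forall g x y, d (g * x)%g (g * y)%g = d x y.

Definition proper_metric (R : realType) (d : G -> G -> R) : Prop :=
  forall x (r : R), finite_set [set y | d x y <= r].

Definition normal_subgroup N : Prop :=
  group_closed (mem N) /\ forall n g, N n -> N (n ^ g)%g.

Definition lcoset_set g N : set G := [set (g * n)%g | n in N].

Definition lcosets_set N : set (set G) := range (lcoset_set^~ N).

Definition finite_index N : Prop := finite_set (lcosets_set N).

Definition residually_finite : Prop :=
  forall g, g != 1%g ->
    exists N, [/\ normal_subgroup N, finite_index N & ~ N g].

(* The set [lcosets_set (N k)] is coerced to a type, so that points over *)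
(* different indices are distinct even when the subgroups coincide.      *)
Definition box_space (N : nat -> set G) := {k : nat & lcosets_set (N k)}.

Definition box_coset (N : nat -> set G) (k : nat) g : box_space N :=
  Tagged (fun k => set_type (lcosets_set (N k)))
    (SigSub (mem_set (imageT (lcoset_set^~ (N k)) g))).

Record is_box_metric (R : realType) (dG : G -> G -> R) (N : nat -> set G)
    (d : box_space N -> box_space N -> R) : Prop := IsBoxMetric {
  box_metric : is_metric d ;
  box_quotient : forall k g h,
    is_min (d (box_coset N k g) (box_coset N k h))
      [set dG (g * n)%g (h * m)%g | n in N k & m in N k] ;
  box_diverge : forall M : R, exists K : nat, forall k l : nat,
    k != l -> (K <= k + l)%N ->
    exists2 m, is_min m [set d x y | x in [set x | tag x = k]
                                   & y in [set y | tag y = l]]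
             & M <= m }.

End Groups.

Definition close_fsets (R : realType) (T : choiceType) (e : R)
    (A B : {fset T}) : Prop :=
  (A `&` B)%fset != fset0 /\
  #|` ((A `\` B) `|` (B `\` A))%fset |%:R / #|` (A `&` B)%fset |%:R < e.

Definition property_A (R : realType) (X : choiceType) (d : X -> X -> R) : Prop :=
  forall r e : R, 0 < r -> 0 < e ->
  exists A : X -> {fset X * nat},
    [/\ forall x, A x != fset0,
        forall x y, d x y <= r -> close_fsets e (A x) (A y) &
        exists2 s : R, 0 < s & forall x y n, (y, n) \in A x -> d x y <= s].

Definition naive_property_A (R : realType) (X : choiceType)
    (d : X -> X -> R) : Prop :=
  forall r e : R, 0 < r -> 0 < e ->
  exists A : X -> {fset X},
    [/\ forall x, A x != fset0,
        forall x y, d x y <= r -> close_fsets e (A x) (A y) &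
        exists2 s : R, 0 < s & forall x y, y \in A x -> d x y <= s].

(* Main.v *)
Require Import Defs.
From mathcomp Require Import all_boot all_order all_algebra.
From mathcomp Require Import finmap.
From mathcomp Require Import boolp classical_sets functions cardinality reals.
From mathcomp Require Import zify lra.
Set Implicit Arguments.
Unset Strict Implicit.
Unset Printing Implicit Defensive.
Import Order.TTheory GRing.Theory Num.Theory.
Local Open Scope classical_set_scope.
Local Open Scope ring_scope.

(** Naive property A implies property A by placing the sets [A_x] at height [0]
of [X * nat].  The converse goes through Folner sets of [G].

Let [A] witness property A for a small constant, with supports of radius [s].
For [k] large, the ball of radius [s] of [G] embeds in [Q = G/N_k], and every
[A_x] with [x] in [Q] is contained in the fibers over [x g], [g] in that ball.
Since [N_k] is normal, [G] acts on [Q] on the right, and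
[[
  f g = sum_(x in Q) #{n | (x g, n) in A_x}
]]
is a finitely supported function on [G] ([orbit_mass]) with total mass
[sum_x #|A_x|] ([sum_orbit_mass]).  Reindexing the sum by [x |-> x s] shows
that [f] and its left translate by [s] differ by at most
[sum_x #|A_x \ A_(x s)|] ([sum_orbit_mass_sub]), which is small compared with
the total mass because [x] and [x s] are at distance at most [dG 1 s].  The
sets [A_x] may have different cardinalities, because summing over the whole of
[Q] compares total masses only.  As [f] has natural values, it is the sum of the
indicators of its level sets [{f > t}], and averaging over [t] gives a level
set that is almost invariant under a whole ball of [G]
([level_set_folner], [folner_of_property_A]).

Conversely, let [F] be such a Folner set of [G].  In the pieces of large index
put [A_x = x F]: two points at distance at most [r] are [x] and [x g] with
[dG 1 g <= r], so the two sets are the images of [F] and [g F] under an orbit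
map which is injective on [F] ([close_fsets_folner]).  On the finite union of
the remaining pieces take [A_x] constant, equal to the whole union; the two
regimes do not interact, because distinct pieces are far apart once one of them
has large index ([naive_property_A_of_folner]). *)

(** * Folner sets as level sets *)

Definition translate (G : groupType) (s : G) (F : {fset G}) : {fset G} :=
  [fset (s * g)%g | g in F]%fset.

(** Bounding [F \ sF] suffices, since [F] and [sF] have the same cardinality and
hence so do [F \ sF] and [sF \ F]. *)
Definition folner_set (R : realType) (G : groupType) (W : {fset G}) (e : R)
    (F : {fset G}) : Prop :=
  F != fset0 /\
  forall s, s \in W -> #|` F `\` translate s F|%fset%:R <= e * #|` F|%:R.

Lemma layer_cake (a b M : nat) : (a <= M)%N ->
  (\sum_(t < M) (b <= t < a)%N)%N = (a - b)%N.
Proof.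
move=> aM; rewrite -(big_mkord xpredT (fun t => nat_of_bool (b <= t < a)%N)).
elim: M a aM => [|M IH] a aM.
  by rewrite big_geq //; lia.
rewrite big_nat_recr //=.
have [aM'|Ma] := leqP a M; first by rewrite IH //; lia.
have -> : a = M.+1 by lia.
rewrite (eq_big_nat _ _ (F2 := fun t => nat_of_bool (b <= t < M)%N)).
  by rewrite IH //; case: (leqP b M) => /= ?; lia.
by move=> t /andP[_ tM]; congr nat_of_bool; lia.
Qed.

Lemma card_fset_sum (T : choiceType) (A : {fset T}) (p : pred T) :
  #|` [fset x in A | p x]%fset| = (\sum_(x <- A) p x)%N.
Proof.
rewrite -sum1_size big_fset /= [RHS](bigID p) /= [X in (_ + X)%N]big1.
  by rewrite addn0; apply: eq_bigr => x ->.
by move=> x /negbTE ->.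
Qed.

(** Summed over all levels, the defects of the level sets of [f] give
[sum_g (f g - f (s^-1 g))] and their cardinalities give [sum_g f g], by
[layer_cake].  Hence some nonempty level set is at least as invariant as [f]
itself.  Passing from one [s] to all of [W] simultaneously costs a factor
[#|W|].  The levels are cut down to [B], and the vanishing condition makes [f]
look as if it were supported there for all translations by [W]. *)
Lemma level_set_folner (R : realType) (G : groupType) (B W : {fset G})
    (f : G -> nat) (c : R) :
  (0 < \sum_(g <- B) f g)%N ->
  (forall s g, s \in W -> g \in B -> (s^-1 * g)%g \notin B ->
     f (s^-1 * g)%g = 0%N) ->
  (forall s, s \in W ->
     (\sum_(g <- B) (f g - f (s^-1 * g)%g))%N%:R
       <= c * (\sum_(g <- B) f g)%N%:R) ->
  exists F : {fset G}, folner_set W (#|` W|%:R * c) F.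
Proof.
move=> f_gt0 f_supp f_inv.
(* Any upper bound of f on B would do for the range of levels; the total mass
   is one, and it is positive. *)
pose M := (\sum_(g <- B) f g)%N.
have fM g : g \in B -> (f g <= M)%N.
  by move=> gB; rewrite /M (big_fsetD1 g) //= leq_addr.
pose F t := [fset g in B | (t < f g)%N]%fset.
have cF t : #|` F t| = (\sum_(g <- B) (t < f g)%N)%N := card_fset_sum _ _.
have bdF s t : s \in W ->
    (#|` F t `\` translate s (F t)|%fset
      <= \sum_(g <- B) (f (s^-1 * g)%g <= t < f g))%N.
  move=> sW; rewrite -card_fset_sum; apply: fsubset_leq_card.
  apply/fsubsetP => g; rewrite !inE /= => /andP[gN /andP[gB tg]].
  rewrite gB tg andbT /= leqNgt; apply/negP => ts.
  move/negP: gN; apply; apply/imfsetP; exists (s^-1 * g)%g; last by rewrite mulVKg.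
  rewrite !inE /= ts andbT; apply/negPn/negP => /(f_supp _ _ sW gB) E.
  by rewrite E in ts.
have sumF : (\sum_(t < M) #|` F t|)%N = M.
  transitivity (\sum_(t < M) \sum_(g <- B) (t < f g))%N.
    by apply: eq_bigr => t _; apply: cF.
  rewrite exchange_big /= big_seq [RHS]big_seq; apply: eq_bigr => g gB.
  by rewrite (layer_cake 0 (fM g gB)) subn0.
have sumFs s : s \in W -> (\sum_(t < M) #|` F t `\` translate s (F t)|%fset
    <= \sum_(g <- B) (f g - f (s^-1 * g)%g))%N.
  move=> sW.
  apply: (@leq_trans
    (\sum_(t < M) \sum_(g <- B) (f (s^-1 * g)%g <= t < f g))%N).
    by apply: leq_sum => t _; apply: bdF.
  rewrite exchange_big /= big_seq [leqRHS]big_seq; apply: leq_sum => g gB.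
  by rewrite layer_cake ?fM.
pose bad (t : 'I_M) := (\sum_(s <- W) #|` F t `\` translate s (F t)|%fset)%N.
have [[t tF tb]|no] := pselect (exists2 t : 'I_M, F t != fset0 &
   (bad t)%:R <= #|` W|%:R * c * #|` F t|%:R).
  exists (F t); split=> // s sW; apply: le_trans tb; rewrite ler_nat /bad.
  by rewrite (big_fsetD1 s) //= leq_addr.
exfalso.
(* Otherwise every nonempty level set violates the bound strictly.  There is a
   nonempty one at t = 0, so summing over t contradicts f_inv. *)
have lower (t : 'I_M) : #|` W|%:R * c * #|` F t|%:R <= (bad t)%:R
    ?= iff (F t == fset0).
  apply/leifP; case: ifPn => [/eqP F0|tF].
    rewrite F0 cardfs0 mulr0 /bad big1 // => s _.
    by rewrite F0 fset0D cardfs0.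
  by rewrite ltNge; apply/negP => le; apply: no; exists t.
have M0 : (0 < M)%N := f_gt0.
have : \sum_(t < M) (#|` W|%:R * c * #|` F t|%:R) < \sum_(t < M) (bad t)%:R.
  rewrite (lt_leif (leif_sum (fun t _ => lower t))).
  apply/negP => /forallP/(_ (Ordinal M0)) /= /eqP F0.
  move: f_gt0; rewrite big_seq big1 // => g gB.
  apply/eqP; rewrite -leqn0 leqNgt; apply/negP => fg.
  have : g \in F 0%N by rewrite !inE gB.
  by rewrite F0 inE.
rewrite -mulr_sumr -!natr_sum sumF ltNge => /negP; apply.
rewrite /bad exchange_big /= natr_sum.
apply: (@le_trans _ _ (\sum_(s <- W) c * M%:R)).
  rewrite big_seq [leRHS]big_seq; apply: ler_sum => s sW.
  by apply: le_trans (f_inv s sW); rewrite ler_nat sumFs.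
by rewrite big_const_seq count_predT iter_addr_0 -[leLHS]mulr_natl mulrA.
Qed.

(** * Averaging property A over a finite orbit *)

Section DoubleCounting.
Variables (G : groupType) (X : choiceType) (act : X -> G -> X) (P : {fset X}).
Hypothesis actM : forall x g h, act (act x g) h = act x (g * h)%g.
Hypothesis act1 : forall x, act x 1%g = x.
Hypothesis actP : forall x g, x \in P -> act x g \in P.
Variables (A : X -> {fset X * nat}) (B : {fset G}).

Definition orbit_mass (g : G) : nat :=
  (\sum_(x <- P) \sum_(p <- A x) (p.1 == act x g))%N.

(** Right translation by [s] permutes [P]; this is where the finiteness of the
pieces turns closeness of [A_x] and [A_(x s)] into invariance under [s]. *)
Lemma reindex_act (F : X -> nat) s :
  (\sum_(x <- P) F x = \sum_(x <- P) F (act x s))%N.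
Proof.
have actK : cancel (act^~ s) (act^~ s^-1%g).
  by move=> x; rewrite actM mulgV act1.
rewrite -[RHS](big_map (act^~ s) xpredT F); apply: perm_big.
apply: uniq_perm => //.
  by rewrite map_inj_uniq //; apply: can_inj actK.
move=> x; apply/idP/mapP => [xP|[y yP ->]]; last exact: actP.
by exists (act x s^-1%g); [exact: actP | rewrite actM mulVg act1].
Qed.

Lemma sum_eq_inj (D : {fset X * nat}) (h : G -> X) : {in B &, injective h} ->
  (\sum_(g <- B) \sum_(p <- D) (p.1 == h g) <= #|` D|)%N.
Proof.
move=> hI; rewrite exchange_big /= -sum1_size; apply: leq_sum => p _.
have [/existsP[[g gB] /= /eqP pg]|no] := boolP [exists g : B, p.1 == h (val g)].
  rewrite (big_fsetD1 g) //= pg eqxx big_seq big1 // => g'.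
  rewrite !inE => /andP[g'g g'B]; apply/eqP; rewrite eqb0.
  by apply: contra g'g => /eqP /(hI _ _ gB g'B) ->.
rewrite big_seq big1 // => g gB; apply/eqP; rewrite eqb0.
by apply: contra no => pg; apply/existsP; exists [` gB]%fset.
Qed.

Lemma sum_eq_cover (D : {fset X * nat}) (h : G -> X) :
  (forall p, p \in D -> exists2 g, g \in B & p.1 = h g) ->
  (#|` D| <= \sum_(g <- B) \sum_(p <- D) (p.1 == h g))%N.
Proof.
move=> cov; rewrite exchange_big /= -sum1_size big_seq [leqRHS]big_seq.
apply: leq_sum => p /cov[g gB pg].
by rewrite (big_fsetD1 g) //= pg eqxx.
Qed.

Lemma sub_sum_fset (D E : {fset X * nat}) (F : X * nat -> nat) :
  (\sum_(p <- D) F p - \sum_(p <- E) F p <= \sum_(p <- D `\` E) F p)%fset%N.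
Proof.
rewrite leq_subLR (big_fsetID _ (mem E) D) /=.
rewrite [in leqRHS](big_fsetID _ (mem D) E) /=.
have -> : [fset x in E | x \in D]%fset = [fset x in D | x \in E]%fset.
  by apply/fsetP => x; rewrite !inE /= andbC.
have -> : [fset x in D | x \notin E]%fset = (D `\` E)%fset.
  by apply/fsetP => x; rewrite !inE /= andbC.
by rewrite leq_add2r leq_addr.
Qed.

Lemma sum_orbit_mass :
  (forall x, x \in P -> {in B &, injective (act x)}) ->
  (forall x p, x \in P -> p \in A x -> exists2 g, g \in B & p.1 = act x g) ->
  (\sum_(g <- B) orbit_mass g = \sum_(x <- P) #|` A x|)%N.
Proof.
move=> actI cov; rewrite /orbit_mass exchange_big /= big_seq [RHS]big_seq.
apply: eq_bigr => x xP; apply/eqP; rewrite eqn_leq.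
rewrite sum_eq_inj ?sum_eq_cover //; last exact: actI.
by move=> p; apply: cov.
Qed.

(** Replacing [x] by [x s] in [f (s^-1 g) = sum_x #{n | (x s^-1 g, n) in A_x}]
turns it into [sum_x #{n | (x g, n) in A_(x s)}], to be compared with
[f g = sum_x #{n | (x g, n) in A_x}]. *)
Lemma sum_orbit_mass_sub s :
  (forall x, x \in P -> {in B &, injective (act x)}) ->
  (\sum_(g <- B) (orbit_mass g - orbit_mass (s^-1 * g)%g)
    <= \sum_(x <- P) #|` A x `\` A (act x s)|%fset)%N.
Proof.
move=> actI.
apply: (@leq_trans (\sum_(g <- B) \sum_(x <- P)
    \sum_(p <- A x `\` A (act x s)) (p.1 == act x g))%fset%N).
  apply: leq_sum => g _; rewrite {2}/orbit_mass (reindex_act _ s).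
  rewrite leq_subLR -big_split /=; apply: leq_sum => x _.
  by rewrite actM mulVKg -leq_subLR sub_sum_fset.
rewrite exchange_big /= big_seq [leqRHS]big_seq.
by apply: leq_sum => x xP; apply/sum_eq_inj/actI.
Qed.

Lemma orbit_mass_neq0 g :
  (forall x p, x \in P -> p \in A x -> exists2 g, g \in B & p.1 = act x g) ->
  orbit_mass g != 0%N ->
  exists x h, [/\ x \in P, h \in B & act x g = act x h].
Proof.
move=> cov; rewrite /orbit_mass sum_nat_seq_neq0 => /hasP[x xP] /=.
rewrite sum_nat_seq_neq0 => /hasP[p pA] /=.
rewrite eqb0 negbK => /eqP pg; have [h hB ph] := cov _ _ xP pA.
by exists x, h; split; rewrite // -pg.
Qed.


End DoubleCounting.

(** * Closeness of finite sets *)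

Lemma close_fsetsD (R : realType) (T : choiceType) (e : R) (A B : {fset T}) :
  0 <= e -> close_fsets e A B -> #|` A `\` B|%fset%:R <= e * #|` A|%:R.
Proof.
move=> e0 [AB]; have c0 : (0 : R) < #|` A `&` B|%fset%:R.
  by rewrite ltr0n cardfs_gt0.
rewrite ltr_pdivrMr // => /ltW le.
apply: (@le_trans _ _ #|` (A `\` B) `|` (B `\` A)|%fset%:R).
  by rewrite ler_nat fsubset_leq_card // fsubsetUl.
apply: le_trans le _; apply: ler_wpM2l => //.
by rewrite ler_nat fsubset_leq_card // fsubsetIl.
Qed.

Lemma close_fsets_refl (R : realType) (T : choiceType) (e : R) (A : {fset T}) :
  0 < e -> A != fset0 -> close_fsets e A A.
Proof.
by move=> e0 A0; split; rewrite ?fsetIid // fsetDv fsetU0 cardfs0 mul0r.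
Qed.

Lemma card_translate (G : groupType) (s : G) (F : {fset G}) :
  #|` translate s F| = #|` F|.
Proof. by rewrite card_imfset //= => x y /mulgI. Qed.

(** A map does not increase the cardinality of a difference, and injectivity on
[F] preserves that of the intersection of [F] and [sF].  So the ratio for the
images is at most the one for [F] and [sF], hence at most [2 c / (1 - c)], and
[c * (2 + e) < e] says that this is less than [e]. *)
Lemma close_fsets_folner (R : realType) (G : groupType) (X : choiceType)
    (h : G -> X) (W F : {fset G}) (e c : R) (s : G) :
  0 < e -> c * (2 + e) < e -> folner_set W c F -> s \in W ->
  {in F &, injective h} ->
  close_fsets e [fset h g | g in F]%fset [fset h g | g in translate s F]%fset.
Proof.
move=> e0 ce [F0 Finv] sW hI; have {Finv sW} := Finv s sW.
set sF := translate s F => lec.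
have n0 : (0 : R) < #|` F|%:R by rewrite ltr0n cardfs_gt0.
have cI : (#|` F `&` sF|%fset + #|` F `\` sF|%fset = #|` F|)%N by rewrite cardfsID.
have cD : (#|` sF `\` F| = #|` F `\` sF|)%fset%N.
  have := cardfsID F sF; rewrite fsetIC card_translate -cI.
  by move/addnI.
have hD (C D : {fset G}) : (#|` [fset h g | g in C] `\` [fset h g | g in D]|
    <= #|` C `\` D|)%fset%N.
  apply: (@leq_trans #|` [fset h g | g in C `\` D]|%fset).
    apply: fsubset_leq_card; apply/fsubsetP => y; rewrite inE.
    move=> /andP[yD /imfsetP[g /= gC yg]]; apply/imfsetP; exists g => //=.
    rewrite inE gC andbT; apply: contra yD => gD.
    by apply/imfsetP; exists g.
  exact: leq_imfset_card.
have hS := hD F sF; have hS' := hD sF F.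
have hcap : (#|` F `&` sF| <=
    #|` [fset h g | g in F] `&` [fset h g | g in sF]|)%fset%N.
  have <- : #|` [fset h g | g in F `&` sF]%fset| = #|` F `&` sF|%fset.
    by apply: card_in_imfset => x y /fsetIP[xF _] /fsetIP[yF _]; apply: hI.
  apply: fsubset_leq_card; apply/fsubsetP => y /imfsetP[g /=].
  move=> /fsetIP[gF gs] ->.
  by apply/fsetIP; split; apply/imfsetP; exists g.
set U := ([fset h g | g in F] `&` [fset h g | g in sF])%fset in hcap *.
have hU : #|` ([fset h g | g in F] `\` [fset h g | g in sF])
    `|` ([fset h g | g in sF] `\` [fset h g | g in F])|%fset%:R
    <= 2 * (c * #|` F|%:R) :> R.
  apply: (@le_trans _ _ (2 * #|` F `\` sF|%fset%:R)); last first.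
    by rewrite ler_pM2l.
  rewrite -natrM ler_nat.
  rewrite (leq_trans (leq_card_fsetU _ _)) // mul2n -addnn.
  by apply: leq_add => //; rewrite -cD.
have hI' : (1 - c) * #|` F|%:R <= #|` U|%:R :> R.
  apply: (@le_trans _ _ #|` F `&` sF|%fset%:R); last by rewrite ler_nat.
  have -> : #|` F `&` sF|%fset%:R = #|` F|%:R - #|` F `\` sF|%fset%:R :> R.
    by rewrite -cI natrD addrK.
  by rewrite mulrBl mul1r lerB.
have c1 : 0 < 1 - c by nra.
have U0 : (0 : R) < #|` U|%:R by apply: lt_le_trans hI'; apply: mulr_gt0.
split; first by rewrite -cardfs_gt0 -(ltr0n R).
rewrite ltr_pdivrMr //; apply: le_lt_trans hU _.
apply: lt_le_trans (ler_wpM2l (ltW e0) hI').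
by rewrite !mulrA ltr_pM2r //; nra.
Qed.

(** * Geometry of the box space *)

Section BoxSpace.
Variables (R : realType) (G : groupType) (dG : G -> G -> R).
Variables (N : nat -> set G) (d : box_space N -> box_space N -> R).
Hypotheses (dG_metric : is_metric dG) (dG_inv : left_invariant dG).
Hypothesis dG_proper : proper_metric dG.
Hypothesis N_desc : forall k, N k.+1 `<=` N k.
Hypothesis N_normal : forall k, normal_subgroup (N k).
Hypothesis N_index : forall k, finite_index (N k).
Hypothesis N_cap : \bigcap_k N k = [set 1%g].
Hypothesis d_box : is_box_metric dG d.

Lemma subg1 k : N k 1%g.
Proof. by have [[/set_mem ? _] _] := N_normal k. Qed.

Lemma subgM k g h : N k g -> N k h -> N k (g * h)%g.
Proof.
move=> /mem_set gN /mem_set hN; apply: set_mem.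
exact: (group_closedM (N_normal k).1).
Qed.

Lemma subgV k g : N k g -> N k g^-1%g.
Proof.
by move=> /mem_set gN; apply: set_mem; apply: (group_closedV (N_normal k).1).
Qed.

Lemma box_coset_eq k g h :
  box_coset N k g = box_coset N k h <-> N k (g^-1 * h)%g.
Proof.
split=> [gh|ghN].
  have /= E := congr1 (fun x : box_space N => val (tagged x)) gh.
  have [n nN <-] : lcoset_set g (N k) h.
    by rewrite E; exists 1%g; [exact: subg1 | rewrite mulg1].
  by rewrite mulKg.
congr Tagged; apply: val_inj => /=; apply/seteqP; split=> _ [n nN <-].
  exists ((g^-1 * h)^-1 * n)%g; first by apply: subgM => //; apply: subgV.
  by rewrite invgM invgK !mulgA mulgV mul1g.
exists (g^-1 * h * n)%g; first exact: subgM.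
by rewrite !mulgA mulgV mul1g.
Qed.

Definition box_rep (x : box_space N) : G :=
  xget 1%g [set h | x = box_coset N (tag x) h].

Lemma box_repK x : box_coset N (tag x) (box_rep x) = x.
Proof.
apply/esym; apply: (@xgetPex _ 1%g [set h | x = box_coset N (tag x) h]).
case: x => k [C CN]; have [h _ hC] := set_mem CN.
by exists h => /=; congr Tagged; apply: val_inj; rewrite /= hC.
Qed.

(** Right multiplication of cosets; it is independent of the representative
because the subgroups are normal. *)
Definition box_act (x : box_space N) (g : G) : box_space N :=
  box_coset N (tag x) (box_rep x * g)%g.

Lemma box_act_coset k h g :
  box_act (box_coset N k h) g = box_coset N k (h * g)%g.
Proof.
apply/box_coset_eq => /=.
have /box_coset_eq := box_repK (box_coset N k h).
move=> /((N_normal k).2 _ g); rewrite /= conjgE invgM.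
by rewrite !mulgA.
Qed.

Lemma box_actM x g h : box_act (box_act x g) h = box_act x (g * h)%g.
Proof. by rewrite [box_act x g]/box_act box_act_coset -mulgA. Qed.

Lemma box_act1 x : box_act x 1%g = x.
Proof. by rewrite /box_act mulg1 box_repK. Qed.

Lemma box_act_eq x g h : box_act x g = box_act x h <-> N (tag x) (g^-1 * h)%g.
Proof. by rewrite box_coset_eq invgM -mulgA mulKg. Qed.

Lemma dG_ge0 g h : 0 <= dG g h.
Proof.
have := metric_triangle dG_metric g h g.
by rewrite (metric_refl dG_metric) (metric_sym dG_metric h g); lra.
Qed.

Lemma d_act_le x g : d x (box_act x g) <= dG 1%g g.
Proof.
rewrite -{1}(box_repK x); have [_] := box_quotient d_box (tag x) (box_rep x)
  (box_rep x * g)%g; apply.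
exists 1%g; first exact: subg1.
exists 1%g; first exact: subg1.
by rewrite !mulg1 -{1}(mulg1 (box_rep x)) dG_inv.
Qed.

(** The quotient distance is an attained minimum, so a pair of representatives
realising it yields a group element of exactly that length. *)
Lemma d_act_lift x y : tag x = tag y ->
  exists2 g, y = box_act x g & dG 1%g g = d x y.
Proof.
move=> xy; have [[n nN [m mN dE]] _] :=
  box_quotient d_box (tag x) (box_rep x) (box_rep y).
exists ((box_rep x * n)^-1 * (box_rep y * m))%g.
  rewrite -[LHS]box_repK -xy; apply/box_coset_eq.
  rewrite invgM !mulgA.
  have -> : ((box_rep y)^-1 * box_rep x * n^-1 * (box_rep x)^-1 * box_rep y * m
    = (n^-1 ^ ((box_rep x)^-1 * box_rep y)) * m)%g.
    by rewrite conjgE invgM invgK !mulgA.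
  by apply: subgM => //; apply: (N_normal _).2; apply: subgV.
rewrite -(dG_inv (box_rep x * n)%g) mulg1 mulVKg dE box_repK.
by rewrite xy box_repK.
Qed.

Definition ball (r : R) : {fset G} := fset_set [set g | dG 1%g g <= r].

Lemma in_ball r g : (g \in ball r) = (dG 1%g g <= r).
Proof.
rewrite in_fset_set; last exact: dG_proper.
by apply/idP/idP => [/set_mem|/mem_set].
Qed.

Lemma ball_sub (r r' : R) : r <= r' -> {subset ball r <= ball r'}.
Proof. by move=> rr' g; rewrite !in_ball => /le_trans; apply. Qed.

Lemma dG_mulV_le g h : dG 1%g (g^-1 * h)%g <= dG 1%g g + dG 1%g h.
Proof.
rewrite -(dG_inv g) mulg1 mulVKg (metric_sym dG_metric 1%g g).
exact: metric_triangle.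
Qed.

Lemma N_mono k l : (k <= l)%N -> N l `<=` N k.
Proof.
move=> /subnK <-; elim: (l - k)%N => [//|n IH] g /N_desc; exact: IH.
Qed.

(** Two elements of a ball of radius [r] acting alike on [x] differ by an
element of the ball of radius [r + r] lying in [N k].  That ball is finite, and
each nontrivial element of it leaves the decreasing [N k] at some stage. *)
Lemma box_act_inj_ball r : exists K, forall x, (K <= tag x)%N ->
  {in ball r &, injective (box_act x)}.
Proof.
have esc g : exists k, g != 1%g -> ~ N k g.
  have [->|g1] := eqVneq g 1%g; first by exists 0%N.
  have [[k kg]|no] := pselect (exists k, ~ N k g); first by exists k.
  have : (\bigcap_k N k) g.
    by move=> k _; have [//|/= kg] := pselect (N k g); case: no; exists k.
  by rewrite N_cap => /= g1'; rewrite g1' eqxx in g1.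
pose k g := projT1 (cid (esc g)).
(* The sum is a convenient upper bound of the k g. *)
exists (\sum_(g <- ball (r + r)) k g)%N => x Kx g h.
rewrite !in_ball => gr hr /box_act_eq ghN.
apply/eqP; apply: contraT => gh.
have ghB : (g^-1 * h)%g \in ball (r + r).
  by rewrite in_ball; apply: le_trans (dG_mulV_le _ _) _; rewrite lerD.
have := projT2 (cid (esc (g^-1 * h)%g)).
rewrite -/(k _) => kN; exfalso; apply: kN.
  by apply: contra gh => /eqP E; rewrite -(mulVKg g h) E mulg1.
apply: N_mono ghN; apply: leq_trans Kx.
by rewrite (big_fsetD1 _ ghB) leq_addr.
Qed.

Lemma far_pieces r : exists K, forall x y, (K <= tag x + tag y)%N ->
  d x y <= r -> tag x = tag y.
Proof.
have [K far] := box_diverge d_box (r + 1).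
exists K => x y Kxy xyr; apply/eqP; apply: contraT => /far/(_ Kxy)[m [_ mlb] rm].
have : m <= d x y by apply: mlb; exists x => //; exists y.
lra.
Qed.

Lemma finite_piece k : finite_set [set x : box_space N | tag x = k].
Proof.
pose f C := box_coset N k (xget 1%g [set g | lcoset_set g (N k) = C]).
apply: sub_finite_set (finite_image f (N_index k)) => x /= xk.
exists (lcoset_set (box_rep x) (N k)); first by exists (box_rep x).
rewrite /f -xk -[RHS]box_repK; apply/box_coset_eq.
set Q := [set g | _]; have : Q (xget 1%g Q).
  by apply: xgetPex; exists (box_rep x).
move: (xget 1%g Q) => g /= gE.
have [n nN <-] : lcoset_set g (N (tag x)) (box_rep x).
  by rewrite gE; exists 1%g; [exact: subg1 | rewrite mulg1].
by rewrite mulKg.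
Qed.

Definition piece k : {fset box_space N} :=
  fset_set [set x : box_space N | tag x = k].

Lemma in_piece k x : (x \in piece k) = (tag x == k).
Proof.
rewrite in_fset_set; last exact: finite_piece.
by apply/idP/eqP => [/set_mem|/mem_set].
Qed.

(** * From property A to Folner sets, and back to naive property A *)

(** Property A is used for the constant [c] divided by the size of the ball of
radius [r], to absorb the factor lost in [level_set_folner]; this is legitimate
as that ball depends on [r] alone.  Injectivity is required on the ball of
radius [r + s], so that translating the ball of radius [s] by an element of
length at most [r] creates no new coincidences in the quotient. *)
Lemma folner_of_property_A (r c : R) : property_A d -> 0 < r -> 0 < c ->
  exists F, folner_set (ball r) c F.
Proof.
move=> dA r0 c0.
have B1 : 1%g \in ball r by rewrite in_ball (metric_refl dG_metric) ltW.
have n0 : (0 : R) < #|` ball r|%:R.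
  by rewrite ltr0n cardfs_gt0; apply/fset0Pn; exists 1%g.
pose e := c / #|` ball r|%:R.
have e0 : 0 < e by rewrite divr_gt0.
have [A [A0 Aclose [s s0 As]]] := dA r e r0 e0.
have [K1 actI] := box_act_inj_ball (r + s).
have [K2 far] := far_pieces s.
pose k := maxn K1 K2; pose P := piece k; pose B := ball s.
have Ptag x : x \in P -> tag x = k by rewrite in_piece => /eqP.
have PI x : x \in P -> {in ball (r + s) &, injective (box_act x)}.
  by move=> /Ptag xk; apply: actI; rewrite xk leq_maxl.
have sB : {subset B <= ball (r + s)} by apply: ball_sub; rewrite lerDr ltW.
have BI x : x \in P -> {in B &, injective (box_act x)}.
  by move=> xP g h gB hB; apply: PI => //; exact: sB.
have actP x g : x \in P -> box_act x g \in P by rewrite !in_piece.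
have cov x p : x \in P -> p \in A x -> exists2 g, g \in B & p.1 = box_act x g.
  case: p => y n xP /As dxy.
  have Kxy : (K2 <= tag x + tag y)%N by rewrite (Ptag x xP); lia.
  have [g yg dg] := d_act_lift (far _ _ Kxy dxy).
  by exists g => //; rewrite in_ball dg.
have mass := sum_orbit_mass BI cov.
have [|||F FW] := @level_set_folner R G B (ball r) (orbit_mass box_act P A) e.
- rewrite mass lt0n sum_nat_seq_neq0; apply/hasP.
  exists (box_coset N k 1%g); first by rewrite -[_ \in _]/(_ \in P) in_piece.
  by rewrite /= cardfs_eq0 A0.
- move=> t g; rewrite !in_ball => tr gs; apply: contraNeq.
  move=> /(orbit_mass_neq0 cov)[x [h [xP hB]]] E.
  rewrite (PI x xP _ _ _ _ E) -?in_ball //; last exact: sB.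
  by rewrite in_ball; apply: le_trans (dG_mulV_le _ _) _; rewrite lerD.
- move=> t; rewrite in_ball => tr; rewrite mass.
  apply: (@le_trans _ _
    (\sum_(x <- P) #|` A x `\` A (box_act x t)|%fset)%N%:R).
    rewrite ler_nat; apply: sum_orbit_mass_sub => //.
    + exact: box_actM.
    + exact: box_act1.
  rewrite !natr_sum mulr_sumr; apply: ler_sum => x _.
  apply: close_fsetsD; first exact: ltW.
  by apply: Aclose; apply: le_trans (d_act_le _ _) tr.
by exists F; move: FW; rewrite mulrC divfK // gt_eqF.
Qed.

Lemma naive_property_A_of_folner :
  (forall r c : R, 0 < r -> 0 < c -> exists F, folner_set (ball r) c F) ->
  naive_property_A d.
Proof.
move=> folner r e r0 e0.
(* With this c, c * (2 + e) < e, as close_fsets_folner demands. *)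
pose c := e / (3 + e).
have c0 : 0 < c by rewrite divr_gt0 // addr_gt0.
have ce : c * (2 + e) < e.
  by rewrite mulrAC ltr_pdivrMr ?addr_gt0 // ltr_pM2l // ltrD2r ltr_nat.
have [F FW] := folner r c r0 c0.
(* The sums s and D are crude bounds for the radius of F and for the diameter of
   the finite union E of the pieces of small index. *)
pose s := \sum_(g <- F) dG 1%g g.
have Fs g : g \in F -> dG 1%g g <= s.
  move=> gF; rewrite /s (big_fsetD1 g) //= lerDl.
  by apply: sumr_ge0 => h _; apply: dG_ge0.
have [K1 actI] := box_act_inj_ball s; have [K2 far] := far_pieces r.
pose K := maxn K1 K2.
pose E := (\bigcup_(k <- iota 0 K) piece k)%fset.
have in_E x : (x \in E) = (tag x < K)%N.
  apply/bigfcupP/idP => [[k]|xK].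
    by rewrite mem_iota in_piece => /andP[/andP[_ kK] _] /eqP ->.
  by exists (tag x); rewrite ?mem_iota ?in_piece ?xK.
pose D := \sum_(x <- E) \sum_(y <- E) d x y.
have d0 x y : 0 <= d x y.
  have := metric_triangle (box_metric d_box) x y x.
  rewrite (metric_refl (box_metric d_box)) (metric_sym (box_metric d_box) y x).
  lra.
have ED x y : x \in E -> y \in E -> d x y <= D.
  move=> xE yE; rewrite /D (big_fsetD1 x) //= (big_fsetD1 y) //= -addrA lerDl.
  by rewrite addr_ge0 ?sumr_ge0 // => z _; rewrite sumr_ge0.
exists (fun x => if x \in E then E else [fset box_act x g | g in F]%fset).
split.
- move=> x; case: ifPn => [xE|_]; first by apply/fset0Pn; exists x.
  have /fset0Pn[g gF] := FW.1.
  by apply/fset0Pn; exists (box_act x g); apply/imfsetP; exists g.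
- move=> x y xyr.
  have [xyE|] := boolP ((x \in E) && (y \in E)).
    case/andP: xyE => xE yE; rewrite xE yE.
    by apply: close_fsets_refl => //; apply/fset0Pn; exists x.
  rewrite !in_E negb_and -!leqNgt => xyK.
  have Kxy : (K <= tag x + tag y)%N.
    by case/orP: xyK => le; apply: leq_trans le _; rewrite ?leq_addr ?leq_addl.
  have xy := far _ _ (leq_trans (leq_maxr _ _) Kxy) xyr.
  have Kx : (K <= tag x)%N by move: xyK; rewrite -xy orbb.
  rewrite -xy ltnNge Kx /=.
  have [g yg dg] := d_act_lift xy.
  have -> : [fset box_act y h | h in F]%fset
      = [fset box_act x h | h in translate g F]%fset.
    rewrite /translate -imfset_comp; apply: eq_imfset => // h /=.
    by rewrite yg box_actM.
  apply: (close_fsets_folner e0 ce FW); first by rewrite in_ball dg.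
  move=> h h' hF h'F; apply: actI; rewrite ?in_ball ?Fs //.
  by apply: leq_trans Kx; rewrite leq_maxl.
exists (`|D| + `|s| + 1) => [|x y]; first by rewrite ltr_wpDl ?addr_ge0.
have := ler_norm D; have := ler_norm s; have := normr_ge0 D; have := normr_ge0 s.
case: ifPn => [xE ? ? ? ? yE|_ ? ? ? ? /imfsetP[g /= gF ->]].
  by have := ED x y xE yE; lra.
by have := d_act_le x g; have := Fs g gF; lra.
Qed.

End BoxSpace.

Lemma naive_property_AW (R : realType) (X : choiceType) (d : X -> X -> R) :
  naive_property_A d -> property_A d.
Proof.
move=> dA r e r0 e0; have [A [A0 Aclose [s s0 As]]] := dA r e r0 e0.
pose j (y : X) := (y, 0%N).
have jI : injective j by move=> y z [].
exists (fun x => [fset j y | y in A x]%fset); split.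
- move=> x; have /fset0Pn[y yA] := A0 x.
  by apply/fset0Pn; exists (j y); apply/imfsetP; exists y.
- move=> x y /Aclose[AI].
  have jE (C : {fset X}) p :
      (p \in [fset j y | y in C]%fset) = (p.1 \in C) && (p.2 == 0%N).
    case: p => z n; apply/imfsetP/andP => [[w /= wC [-> ->]] //|[/= zC /eqP ->]].
    by exists z.
  have jD : ([fset j y | y in A x] `\` [fset j y | y in A y] `|`
      ([fset j y | y in A y] `\` [fset j y | y in A x]) =
      [fset j y | y in (A x `\` A y) `|` (A y `\` A x)])%fset.
    apply/fsetP => p; rewrite !(jE, inE) /=.
    by case: (p.2 == _); rewrite ?andbF ?andbT.
  rewrite /close_fsets jD -imfsetI; last by move=> ? ? _ _; apply: jI.
  have jC (C : {fset X}) : #|` [fset j y | y in C]%fset| = #|` C|.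
    by rewrite card_imfset.
  by rewrite !jC; split=> //; rewrite -cardfs_eq0 jC cardfs_eq0.
exists s => // x y n /imfsetP[z /= zA [-> _]]; exact: As.
Qed.

Theorem theoremE (R : realType) (G : groupType) (dG : G -> G -> R)
    (N : nat -> set G) (d : box_space N -> box_space N -> R)
    (G_countable : countable [set: G])
    (G_rf : residually_finite G)
    (dG_metric : is_metric dG)
    (dG_inv : left_invariant dG)
    (dG_proper : proper_metric dG)
    (N0 : N 0%N = [set: G])
    (N_desc : forall k, N k.+1 `<=` N k)
    (N_normal : forall k, normal_subgroup (N k))
    (N_index : forall k, finite_index (N k))
    (N_cap : \bigcap_k N k = [set 1%g])
    (d_box : is_box_metric dG d) :
  property_A d <-> naive_property_A d.
Proof.
split=> [dA|]; last exact: naive_property_AW.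
apply: (naive_property_A_of_folner dG_metric dG_inv dG_proper N_desc N_normal
  N_index N_cap d_box) => r c r0 c0.
exact: (folner_of_property_A dG_metric dG_inv dG_proper N_desc N_normal N_index
  N_cap d_box).
Qed.
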